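(* Let $G=(V,E)$ be a finite graph, $\mathcal{S}=\{S_i\}_{i\in V}$ a scale on $G$ and $\overline{\mathcal{S}}=\{\overline{S}_i\}_{i\in V}$ its dual scale. Let $\mathcal{T}$ be the collection of all $T\subset V$ contained in some $\overline{S}\in\overline{\mathcal{S}}$. Let $(\mathbf{z},a)$, $\mathbf{z}=(z_T)_{T\in\mathcal{T}}$, be an admissible solution of problem (Z) from the context. For each $T\in\mathcal{T}$ let $$\psi_T(i)=\begin{cases}z_T&\text{if }i\in T,\\0&\text{otherwise.}\end{cases}$$ Then $\{\psi_T\}_{T\in\mathcal{T}}$ is a flat partition of unity subordinated to $\overline{\mathcal{S}}$ with $a$-variation.
   Context: A graph $G=(V,E)$ is oriented, with $E\subset V\times V$ and no self-loops. A scale on $G$ is a family $\mathcal{S}=\{S_i\}_{i\in V}$ of subsets of $V$; its dual scale is $\overline{\mathcal{S}}=\{\overline{S}_i\}_{i\in V}$ with $\overline{S}_i=\{j\in V: i\in S_j\}$. For $T\subset V$ the edge boundary is $\partial T=\big((T\times(V\setminus T))\cup((V\setminus T)\times T)\big)\cap E$. (Z): minimize $a$ subject to - $\sum_{T\in\mathcal{T}:\,ij\in\partial T}z_T\le a$ for each $ij\in E$; - $\sum_{T\in\mathcal{T}:\,i\in T}z_T=1$ for each $i\in V$; - $z_T\ge 0$ for each $T\in\mathcal{T}$, and $a\ge 0$. Flat partition of unity with $a$-variation subordinated to a family $\mathcal{U}$ of subsets of $V$: a finite family $\{\psi_\alpha\}$ of functions $\psi_\alpha\colon V\to\mathbb{R}$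 with $\psi_\alpha\ge 0$; each $\psi_\alpha$ constant on its support $\{i:\psi_\alpha(i)>0\}$; $\sum_\alpha\psi_\alpha(i)=1$ for each $i\in V$; $\sum_\alpha|\psi_\alpha(k)-\psi_\alpha(j)|\le a$ for each $kj\in E$; and for each $\alpha$ there is $U\in\mathcal{U}$ with $\{i:\psi_\alpha(i)>0\}\subset U$. *)

(* Defs.v *)
From mathcomp Require Import all_boot all_order all_algebra reals.

Set Implicit Arguments.
Unset Strict Implicit.
Unset Printing Implicit Defensive.

Import Order.TTheory GRing.Theory Num.Theory.
Local Open Scope ring_scope.

Record oriented_graph (V : finType) := OrientedGraph {
  edges : {set V * V};
  edges_no_loop : forall i : V, (i, i) \notin edges
}.

(* The members of a scale are arbitrary: i \in S i is not required. *)
Definition scale (V : finType) := V -> {set V}.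

Definition dual_scale (V : finType) (S : scale V) : scale V :=
  fun i => [set j | i \in S j].

Definition edge_boundary (V : finType) (G : oriented_graph V) (T : {set V}) :
    {set V * V} :=
  (setX T (~: T) :|: setX (~: T) T) :&: edges G.

Definition subsets_within (V J : finType) (U : J -> {set V}) : {set {set V}} :=
  [set T : {set V} | [exists j, T \subset U j]].

Record admissible_Z (R : realType) (V : finType) (G : oriented_graph V)
    (TT : {set {set V}}) (z : {T : {set V} | T \in TT} -> R) (a : R) : Prop :=
  AdmissibleZ {
    Z_boundary : forall i j : V, (i, j) \in edges G ->
      \sum_(T : {T : {set V} | T \in TT}
             | (i, j) \in edge_boundary G (val T)) z T <= a;
    Z_cover : forall i : V,
      \sum_(T : {T : {set V} | T \in TT} | i \in val T) z T = 1;
    Z_ge0 : forall T, 0 <= z T;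
    Z_bound_ge0 : 0 <= a
  }.

Definition supp (R : realType) (V : finType) (f : V -> R) : {set V} :=
  [set i | 0 < f i].

Record flat_partition_of_unity (R : realType) (V : finType)
    (G : oriented_graph V) (J : Type) (U : J -> {set V}) (a : R)
    (I : finType) (psi : I -> V -> R) : Prop := FlatPartitionOfUnity {
  fpu_ge0 : forall al i, 0 <= psi al i;
  fpu_flat : forall al, {in supp (psi al) &, forall i j, psi al i = psi al j};
  fpu_sum1 : forall i, \sum_(al : I) psi al i = 1;
  fpu_variation : forall k j, (k, j) \in edges G ->
    \sum_(al : I) `|psi al k - psi al j| <= a;
  fpu_subordinated : forall al, exists u : J, supp (psi al) \subset U u
}.

Definition weighted_indicator (R : realType) (V : finType)
    (TT : {set {set V}}) (z : {T : {set V} | T \in TT} -> R) :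
    {T : {set V} | T \in TT} -> V -> R :=
  fun T i => if i \in val T then z T else 0.

(* Main.v *)
Require Import Defs.
From mathcomp Require Import all_boot all_order all_algebra reals.

(** Each weighted indicator [z_T 1_T] is constant on [T] and vanishes off [T].
    Hence at a vertex [i] the functions sum to the total weight of the sets
    containing [i], and along an edge [kj] the function of [T] varies by [z_T]
    if the edge crosses the boundary of [T] and by [0] otherwise
    ([weighted_indicator_variation]). The covering and boundary constraints of
    (Z) are therefore the unit-sum and variation conditions, and flatness and
    subordination follow from the support of [z_T 1_T] lying in [T]
    ([supp_weighted_indicator]). *)

Set Implicit Arguments.
Unset Strict Implicit.
Unset Printing Implicit Defensive.

Import Order.TTheory GRing.Theory Num.Theory.
Local Open Scope ring_scope.

Lemma in_edge_boundary (V : finType) (G : oriented_graph V) (T : {set V})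
    (k j : V) :
  (k, j) \in edges G ->
  ((k, j) \in edge_boundary G T) = ((k \in T) != (j \in T)).
Proof. by move=> kjE; rewrite !inE kjE andbT; do 2!case: (_ \in T). Qed.

(** Only an inclusion: when [z_T = 0] the support is empty, whatever [T] is. *)
Lemma supp_weighted_indicator (R : realType) (V : finType)
    (TT : {set {set V}}) (z : {T : {set V} | T \in TT} -> R)
    (T : {T : {set V} | T \in TT}) :
  supp (weighted_indicator z T) \subset val T.
Proof.
apply/subsetP => i; rewrite inE /weighted_indicator.
by case: ifP => //; rewrite ltxx.
Qed.

(** Nonnegativity of [z_T] makes the jump across the boundary equal to [z_T]
    whichever of the two endpoints lies in [T]. *)
Lemma weighted_indicator_variation (R : realType) (V : finType)
    (G : oriented_graph V) (TT : {set {set V}})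
    (z : {T : {set V} | T \in TT} -> R) (T : {T : {set V} | T \in TT})
    (k j : V) :
  0 <= z T -> (k, j) \in edges G ->
  `|weighted_indicator z T k - weighted_indicator z T j| =
  if (k, j) \in edge_boundary G (val T) then z T else 0.
Proof.
move=> zT_ge0 kjE; rewrite in_edge_boundary // /weighted_indicator.
do 2!case: (_ \in val T) => /=.
- by rewrite subrr normr0.
- by rewrite subr0 ger0_norm.
- by rewrite sub0r normrN ger0_norm.
- by rewrite subrr normr0.
Qed.

Theorem lemma4p7 (R : realType) (V : finType) (G : oriented_graph V)
    (S : scale V)
    (z : {T : {set V} | T \in subsets_within (dual_scale S)} -> R) (a : R)
    (hza : admissible_Z G z a) :
  flat_partition_of_unity G (dual_scale S) a (weighted_indicator z).
Proof.
case: hza => z_boundary z_cover z_ge0 _; split.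
- by move=> T i; rewrite /weighted_indicator; case: ifP.
- move=> T i j /(subsetP (supp_weighted_indicator _ _)) iT.
  move=> /(subsetP (supp_weighted_indicator _ _)) jT.
  by rewrite /weighted_indicator iT jT.
- by move=> i; rewrite -(z_cover i) [RHS]big_mkcond.
- move=> k j kjE; apply: le_trans (z_boundary k j kjE).
  rewrite [leRHS]big_mkcond; apply: ler_sum => T _.
  by rewrite (weighted_indicator_variation (z_ge0 T) kjE).
- move=> T; have := valP T; rewrite inE => /existsP[u Tu].
  by exists u; apply: subset_trans Tu; apply: supp_weighted_indicator.
Qed.
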